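(* Let $f:\mathbb{R}^n\times\mathbb{R}^m\to\mathbb{R}^n$ be continuously differentiable with $f(0,0)=0$. Let $\Psi:\mathbb{R}^n\to\mathbb{R}^{n_z}$ ($n_z\ge n$) be continuous with $\Psi(0)=0$, and let $A\in\mathbb{R}^{n_z\times n_z}$, $B\in\mathbb{R}^{n_z\times m}$, $C\in\mathbb{R}^{n\times n_z}$ be such that $C\Psi(x)=x$ for all $x\in\mathbb{R}^n$, the pair $(A,B)$ is stabilizable and the pair $(A,C)$ is observable. Let $Q\in\mathbb{R}^{n\times n}$ and $R\in\mathbb{R}^{m\times m}$ be symmetric positive definite. Suppose that $\Psi(f(x,u))=A\Psi(x)+Bu$ for all $x\in\mathbb{R}^n$, $u\in\mathbb{R}^m$. Let $P$ be the unique positive definite solution of $$P=C^{\mathsf T}QC+A^{\mathsf T}PA-A^{\mathsf T}PB(R+B^{\mathsf T}PB)^{-1}B^{\mathsf T}PA$$ and let $K=-(R+B^{\mathsf T}PB)^{-1}B^{\mathsf T}PA$. Then the closed-loop system $x_{t+1}=f(x_t,K\Psi(x_t))$ is globally asymptotically stable (at the origin).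
   Context: Globally asymptotically stable means: (1) globally attractive, i.e. $\lim_{t\to\infty}x_t=0$ for every $x_0\in\mathbb{R}^n$; and (2) Lyapunov stable, i.e. for every $\epsilon>0$ there exists $\delta>0$ such that $\|x_0\|<\delta$ implies $\|x_t\|<\epsilon$ for all $t\in\mathbb{Z}_{\ge 0}$. *)

(* Defs.v *)
From HB Require Import structures.
From mathcomp Require Import all_boot all_order all_algebra.
From mathcomp Require Import complex.
From mathcomp Require Import all_classical all_reals all_analysis.

Set Implicit Arguments.
Unset Strict Implicit.
Unset Printing Implicit Defensive.

Import Order.TTheory GRing.Theory Num.Theory.
Import numFieldNormedType.Exports.

Local Open Scope classical_set_scope.
Local Open Scope ring_scope.

(** The norm on ['cV[R]_n] is the library's sup norm; since all norms on R^n
    are equivalent, none of the notions below depends on this choice. *)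

(** Continuity of the derivative [p |-> 'd f p] is with respect to the operator
    norm on linear maps, written out as a bound on all vectors [v]. *)
Definition continuously_differentiable (R : realType) (V W : normedModType R)
    (f : V -> W) : Prop :=
  (forall p : V, differentiable f p) /\
  (forall (p : V) (e : R), 0 < e ->
     \forall q \near p, forall v : V, `|'d f q v - 'd f p v| <= e * `|v|).

Definition posdefmx (R : realType) (n : nat) (M : 'M[R]_n) : Prop :=
  M^T = M /\ forall x : 'cV[R]_n, x != 0 -> 0 < (x^T *m M *m x) 0 0.

(** Discrete-time stability: every complex eigenvalue lies in the open unit
    disc.  Mathcomp's [eigenvalue] uses row eigenvectors, which gives the same
    spectrum. *)
Definition schur_stable (R : realType) (n : nat) (M : 'M[R]_n) : Prop :=
  forall z : R[i], eigenvalue (map_mx (real_complex R) M) z -> `|z| < 1.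

Definition stabilizable (R : realType) (n m : nat)
    (A : 'M[R]_n) (B : 'M[R]_(n, m)) : Prop :=
  exists F : 'M[R]_(m, n), schur_stable (A + B *m F).

Definition observability_mx (R : realType) (n p : nat)
    (A : 'M[R]_n) (C : 'M[R]_(p, n)) : 'M[R]_(\sum_(i < n) p, n) :=
  \mxcol_(i < n) (C *m A ^+ i).

Definition observable (R : realType) (n p : nat)
    (A : 'M[R]_n) (C : 'M[R]_(p, n)) : Prop :=
  \rank (observability_mx A C) = n.

Definition riccati_eq (R : realType) (n m nz : nat)
    (A : 'M[R]_nz) (B : 'M[R]_(nz, m)) (C : 'M[R]_(n, nz))
    (Q : 'M[R]_n) (Rc : 'M[R]_m) (P : 'M[R]_nz) : Prop :=
  P = C^T *m Q *m C + A^T *m P *m A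
      - A^T *m P *m B *m invmx (Rc + B^T *m P *m B) *m B^T *m P *m A.

Definition lqr_gain (R : realType) (m nz : nat)
    (A : 'M[R]_nz) (B : 'M[R]_(nz, m)) (Rc : 'M[R]_m) (P : 'M[R]_nz) :
    'M[R]_(m, nz) :=
  - (invmx (Rc + B^T *m P *m B) *m B^T *m P *m A).

(** [iter t g x0] is the state at time [t] of [x_{t+1} = g x_t] started from
    [x0]. *)
Definition globally_attractive (R : realType) (n : nat)
    (g : 'cV[R]_n -> 'cV[R]_n) : Prop :=
  forall x0 : 'cV[R]_n, iter t g x0 @[t --> \oo] --> (0 : 'cV[R]_n).

Definition lyapunov_stable (R : realType) (n : nat)
    (g : 'cV[R]_n -> 'cV[R]_n) : Prop :=
  forall e : R, 0 < e -> exists2 d : R, 0 < d &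
    forall x0 : 'cV[R]_n, `|x0| < d -> forall t : nat, `|iter t g x0| < e.

Definition globally_asymptotically_stable (R : realType) (n : nat)
    (g : 'cV[R]_n -> 'cV[R]_n) : Prop :=
  globally_attractive g /\ lyapunov_stable g.

(* Main.v *)
Require Import Defs.
From HB Require Import structures.
From mathcomp Require Import all_boot all_order all_algebra.
From mathcomp Require Import complex.
From mathcomp Require Import all_classical all_reals all_analysis.
From mathcomp Require Import ring lra.

Set Implicit Arguments.
Unset Strict Implicit.
Unset Printing Implicit Defensive.

Import Order.TTheory GRing.Theory Num.Theory.
Import numFieldNormedType.Exports.

Local Open Scope classical_set_scope.
Local Open Scope ring_scope.

(** Write [M = A + B K] for the closed loop of the gain [K] that belongs to [P].
    The lifted state is driven linearly, [Psi (x_{t+1}) = M (Psi x_t)], and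
    [x_t = C (Psi x_t)], so [x_t = C M^t (Psi x_0)].  Hence [M^t --> 0] gives
    attractivity, and also stability, because then [|C M^t|] is bounded in [t]
    and [Psi] is continuous at the origin with [Psi 0 = 0].  What remains is the
    theory of the Riccati equation, with [qf P x = x^T P x].

    Everything rests on one completion of squares ([riccati_completion]): the
    Riccati map sends [P] to the minimum, over all gains [F], of the one-step
    cost [C^T Q C + F^T Rc F + (A + B F)^T P (A + B F)], attained at the gain of
    [P].  So the Riccati map is monotone, and a bound for one gain is a bound
    for the map.

    Convergence ([riccati_closed_loop_cvg0]): along [y_{k+1} = M y_k] a positive
    definite solution [P] is a Lyapunov function whose decrease at step [k] is
    [qf Q (C y_k) + qf Rc (K y_k)].  Since [qf P (y_k)] converges, outputs
    [C y_k] and inputs [K y_k] tend to 0, and then observability forces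
    [y_k --> 0] ([cvg_observable]).

    Uniqueness ([riccati_sol_le]): for two positive definite solutions, the
    minimum property with the gain of [P'] makes [qf P - qf P'] nondecreasing
    along the closed loop of [P'], where it tends to 0.  So [P <= P'], and by
    symmetry [P = P'].

    Existence ([riccati_sol_exists]): the iterates of the Riccati map from 0
    increase.  They are bounded by the total cost of a stabilizing gain, which
    is finite because the powers of a Schur stable matrix are summable
    ([schur_stable_summable]).  Their limit is a fixed point because the map is
    continuous, and observability makes it definite ([riccati_sol_posdef]). *)

(** * Convergence of matrix sequences *)

Lemma mx_entry_le_norm (R : realType) (p q : nat) (X : 'M[R]_(p, q)) i j :
  `|X i j| <= `|X|.
Proof.
rewrite [leRHS]/Num.norm /= mx_normrE.
by apply/bigmax_geP; right; exists (i, j).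
Qed.

Lemma mx_norm_le_entries (R : realType) (p q : nat) (X : 'M[R]_(p, q)) (c : R) :
  0 <= c -> (forall i j, `|X i j| <= c) -> `|X| <= c.
Proof.
move=> c0 Xc; rewrite [leLHS]/Num.norm /= mx_normrE.
by apply/bigmax_leP; split=> // -[i j] _; exact: Xc.
Qed.

Lemma mulmx_norm_le (R : realType) (p q r : nat)
    (X : 'M[R]_(p, q)) (Y : 'M[R]_(q, r)) :
  `|X *m Y| <= q%:R * `|X| * `|Y|.
Proof.
apply: mx_norm_le_entries => [|i k]; first by rewrite !mulr_ge0.
rewrite mxE (le_trans (ler_norm_sum _ _ _)) //.
rewrite (@le_trans _ _ (\sum_(j < q) `|X| * `|Y|)) //.
  apply: ler_sum => j _.
  by rewrite normrM ler_pM // mx_entry_le_norm.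
by rewrite sumr_const card_ord -mulrA mulr_natl.
Qed.

(** The norm is a maximum of finitely many entries, so limits of matrices can be
    computed in the base field. *)
Lemma mx_cvgP (R : realType) (p q : nat) (X : nat -> 'M[R]_(p, q))
    (L : 'M[R]_(p, q)) :
  X k @[k --> \oo] --> L <-> forall i j, X k i j @[k --> \oo] --> L i j.
Proof.
split=> [XL i j|XL].
  apply/cvgrPdist_le => e e0; move/cvgrPdist_le: XL => /(_ e e0).
  apply: filterS => k; apply: le_trans.
  by have := mx_entry_le_norm (L - X k) i j; rewrite !mxE.
apply/cvgrPdist_le => e e0.
have : \forall k \near \oo, forall ij : 'I_p * 'I_q,
    `|L ij.1 ij.2 - X k ij.1 ij.2| <= e.
  by apply: filter_forall => ij; move/cvgrPdist_le: (XL ij.1 ij.2); exact.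
apply: filterS => k Xk; apply: mx_norm_le_entries; first exact: ltW.
by move=> i j; rewrite !mxE; exact: (Xk (i, j)).
Qed.

Lemma cvg_mulmx (R : realType) (p q r : nat) (X : nat -> 'M[R]_(p, q))
    (Y : nat -> 'M[R]_(q, r)) (L : 'M[R]_(p, q)) (M : 'M[R]_(q, r)) :
  X k @[k --> \oo] --> L -> Y k @[k --> \oo] --> M ->
  X k *m Y k @[k --> \oo] --> L *m M.
Proof.
move=> /mx_cvgP XL /mx_cvgP YM; apply/mx_cvgP => i k.
rewrite mxE; under eq_fun do rewrite mxE.
apply: cvg_big; first exact: pseudometric_normed_Zmodule.add_continuous.
by move=> j _; exact: cvgM.
Qed.

Lemma cvg_det (R : realType) (p : nat) (X : nat -> 'M[R]_p) (L : 'M[R]_p) :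
  X k @[k --> \oo] --> L -> \det (X k) @[k --> \oo] --> \det L.
Proof.
move=> /mx_cvgP XL.
apply: cvg_big; first exact: pseudometric_normed_Zmodule.add_continuous.
move=> s _; apply: cvgMl_tmp.
apply: cvg_big; first exact: mul_continuous.
by move=> i _; exact: XL.
Qed.

(** The inverse is the adjugate over the determinant, and both are polynomials
    in the entries. *)
Lemma cvg_invmx (R : realType) (p : nat) (X : nat -> 'M[R]_p) (L : 'M[R]_p) :
  (forall k, X k \in unitmx) -> L \in unitmx ->
  X k @[k --> \oo] --> L -> invmx (X k) @[k --> \oo] --> invmx L.
Proof.
move=> Xu Lu XL; rewrite /invmx Lu; under eq_fun do rewrite Xu.
apply/mx_cvgP => i j; rewrite !mxE; under eq_fun do rewrite !mxE.
apply: cvgM.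
  by apply: cvgV; [rewrite -unitfE -unitmxE|exact: cvg_det].
apply: cvgMl_tmp; apply: cvg_det; apply/mx_cvgP => a b.
rewrite !mxE; under eq_fun do rewrite !mxE.
by move/mx_cvgP: XL; exact.
Qed.

(** * Quadratic forms *)

Definition qf (R : realType) (p : nat) (M : 'M[R]_p) (x : 'cV[R]_p) : R :=
  (x^T *m M *m x) 0 0.

Lemma qfD (R : realType) (p : nat) (M N : 'M[R]_p) x :
  qf (M + N) x = qf M x + qf N x.
Proof. by rewrite /qf mulmxDr mulmxDl mxE. Qed.

Lemma qf_congr (R : realType) (p q : nat) (M : 'M[R]_p) (T : 'M[R]_(p, q)) x :
  qf (T^T *m M *m T) x = qf M (T *m x).
Proof. by rewrite /qf trmx_mul !mulmxA. Qed.

Lemma cvg_qf (R : realType) (p : nat) (X : nat -> 'M[R]_p) L x :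
  X k @[k --> \oo] --> L -> qf (X k) x @[k --> \oo] --> qf L x.
Proof.
move=> XL; rewrite /qf.
have /mx_cvgP : x^T *m X k *m x @[k --> \oo] --> x^T *m L *m x.
  by apply: cvg_mulmx; [apply: cvg_mulmx => //|]; exact: cvg_cst.
exact.
Qed.

(** A symmetric matrix is recovered from its quadratic form; this turns
    statements on [qf], such as convergence, into statements on entries. *)
Lemma qf_polar (R : realType) (p : nat) (M : 'M[R]_p) (i j : 'I_p) :
  M^T = M ->
  M i j = 2^-1 * (qf M (delta_mx i 0 + delta_mx j 0)
                  - qf M (delta_mx i 0) - qf M (delta_mx j 0)).
Proof.
move=> Msym.
have E a b : ((delta_mx a 0 : 'cV[R]_p)^T *m M *m (delta_mx b 0 : 'cV[R]_p)) 0 0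
    = M a b.
  by rewrite trmx_delta -rowE -colE !mxE.
have -> : qf M (delta_mx i 0 + delta_mx j 0)
    = M i i + M j i + (M i j + M j j).
  rewrite /qf [(_ + _)^T]linearD /= mulmxDr !mulmxDl.
  by rewrite !addrA 3!mxE !E.
have -> : M j i = M i j by rewrite -{1}Msym mxE.
by rewrite /qf !E; field.
Qed.

(** * The Riccati map as a minimum over feedback gains *)

Definition psdmx (R : realType) (p : nat) (M : 'M[R]_p) : Prop :=
  M^T = M /\ forall x : 'cV[R]_p, 0 <= qf M x.

Lemma posdef_psdmx (R : realType) (p : nat) (M : 'M[R]_p) :
  posdefmx M -> psdmx M.
Proof.
move=> [Msym Mpos]; split=> // x; have [->|x0] := eqVneq x 0.
  by rewrite /qf mulmx0 mxE.
exact/ltW/Mpos.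
Qed.

Lemma posdef_qf0 (R : realType) (p : nat) (M : 'M[R]_p) x :
  posdefmx M -> qf M x = 0 -> x = 0.
Proof.
move=> [_ Mpos] Mx0; apply/eqP/negPn/negP => /Mpos.
by rewrite -/(qf M x) Mx0 ltxx.
Qed.

Lemma posdef_unitmx (R : realType) (p : nat) (M : 'M[R]_p) :
  posdefmx M -> M \in unitmx.
Proof.
move=> Mpd; rewrite -row_free_unit; apply: inj_row_free => v vM.
apply: trmx_inj; rewrite trmx0; apply: (posdef_qf0 Mpd).
by rewrite /qf trmxK vM mul0mx mxE.
Qed.

Lemma psdmx_congr (R : realType) (p q : nat) (M : 'M[R]_p)
    (T : 'M[R]_(p, q)) : psdmx M -> psdmx (T^T *m M *m T).
Proof.
move=> [Msym M0]; split=> [|x]; last by rewrite qf_congr.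
by rewrite !trmx_mul trmxK Msym mulmxA.
Qed.

Lemma psdmxD (R : realType) (p : nat) (M N : 'M[R]_p) :
  psdmx M -> psdmx N -> psdmx (M + N).
Proof.
move=> [Ms M0] [Ns N0]; split=> [|x]; first by rewrite linearD /= Ms Ns.
by rewrite qfD addr_ge0.
Qed.

Lemma posdefmxD (R : realType) (p : nat) (M N : 'M[R]_p) :
  posdefmx M -> psdmx N -> posdefmx (M + N).
Proof.
move=> [Ms M0] [Ns N0]; split=> [|x x0]; first by rewrite linearD /= Ms Ns.
by rewrite -/(qf _ x) qfD ltr_wpDr // M0.
Qed.

(** [riccati_eq A B C Q Rc P] says that [P] is a fixed point of this map. *)
Definition riccati_map (R : realType) (n m nz : nat)
    (A : 'M[R]_nz) (B : 'M[R]_(nz, m)) (C : 'M[R]_(n, nz))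
    (Q : 'M[R]_n) (Rc : 'M[R]_m) (P : 'M[R]_nz) : 'M[R]_nz :=
  C^T *m Q *m C + A^T *m P *m A
    - A^T *m P *m B *m invmx (Rc + B^T *m P *m B) *m B^T *m P *m A.

(** As a quadratic form in the state, the running cost [y^T Q y + u^T Rc u] for
    the output [y = C x] under the feedback [u = F x]. *)
Definition stage_cost (R : realType) (n m nz : nat) (C : 'M[R]_(n, nz))
    (Q : 'M[R]_n) (Rc : 'M[R]_m) (F : 'M[R]_(m, nz)) : 'M[R]_nz :=
  C^T *m Q *m C + F^T *m Rc *m F.

(** With [G = Rc + B^T P B] the one-step cost is quadratic in [F], with leading
    part [F^T G F] and linear part given by [B^T P A].  The gain satisfies
    [G K = - B^T P A], so [K] is the vertex. *)
Lemma riccati_completion (R : realType) (n m nz : nat)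
    (A : 'M[R]_nz) (B : 'M[R]_(nz, m)) (C : 'M[R]_(n, nz))
    (Q : 'M[R]_n) (Rc : 'M[R]_m) (P : 'M[R]_nz) (F : 'M[R]_(m, nz)) :
  posdefmx Rc -> psdmx P ->
  let K := lqr_gain A B Rc P in
  stage_cost C Q Rc F + (A + B *m F)^T *m P *m (A + B *m F) =
  riccati_map A B C Q Rc P
    + (F - K)^T *m (Rc + B^T *m P *m B) *m (F - K).
Proof.
move=> Rpd Ppsd K; have [Psym _] := Ppsd.
have Gpd := posdefmxD Rpd (psdmx_congr B Ppsd).
rewrite /stage_cost /riccati_map.
set G := Rc + _ in Gpd *; have [Gsym _] := Gpd.
have GK : G *m K = - (B^T *m P *m A).
  by rewrite /K /lqr_gain mulmxN !mulmxA mulmxV ?mul1mx ?posdef_unitmx.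
have KG : K^T *m G = - (A^T *m P *m B).
  by rewrite -{1}Gsym -trmx_mul GK linearN /= !trmx_mul trmxK Psym mulmxA.
have KK : A^T *m P *m B *m invmx G *m B^T *m P *m A = - (A^T *m P *m B *m K).
  by rewrite /K /lqr_gain mulmxN opprK !mulmxA.
(* From here on only the relations [GK], [KG] and [KK] matter; an opaque [K]
   keeps the expansion below from opening the inverse. *)
clearbody K.
have -> : (F - K)^T *m G *m (F - K) = F^T *m Rc *m F + F^T *m B^T *m P *m B *m F
    + F^T *m B^T *m P *m A + A^T *m P *m B *m F - A^T *m P *m B *m K.
  rewrite [(F - K)^T]linearB /= mulmxBl KG opprK mulmxBr !mulmxDl.
  rewrite -(mulmxA _ G K) GK {1}/G !(mulmxDl, mulmxDr, mulmxN, mulNmx) !mulmxA.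
  by apply/matrixP => i j; rewrite !mxE; ring.
rewrite KK [(A + _)^T]linearD /= trmx_mul !(mulmxDl, mulmxDr) !mulmxA.
by apply/matrixP => i j; rewrite !mxE; ring.
Qed.

Lemma riccati_map_gain (R : realType) (n m nz : nat)
    (A : 'M[R]_nz) (B : 'M[R]_(nz, m)) (C : 'M[R]_(n, nz))
    (Q : 'M[R]_n) (Rc : 'M[R]_m) (P : 'M[R]_nz) :
  posdefmx Rc -> psdmx P ->
  let K := lqr_gain A B Rc P in
  riccati_map A B C Q Rc P =
  stage_cost C Q Rc K + (A + B *m K)^T *m P *m (A + B *m K).
Proof.
move=> Rpd Ppsd K; rewrite (riccati_completion A B C Q K Rpd Ppsd).
by rewrite subrr mulmx0 addr0.
Qed.

Lemma qf_riccati_map (R : realType) (n m nz : nat)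
    (A : 'M[R]_nz) (B : 'M[R]_(nz, m)) (C : 'M[R]_(n, nz))
    (Q : 'M[R]_n) (Rc : 'M[R]_m) (P : 'M[R]_nz) x :
  posdefmx Rc -> psdmx P ->
  let K := lqr_gain A B Rc P in
  qf (riccati_map A B C Q Rc P) x =
  qf Q (C *m x) + qf Rc (K *m x) + qf P ((A + B *m K) *m x).
Proof.
by move=> Rpd Ppsd K; rewrite riccati_map_gain // !qfD !qf_congr.
Qed.

(** The Riccati map is a lower bound for the one-step cost of every gain: the
    square completed by [riccati_completion] is nonnegative. *)
Lemma qf_riccati_map_le (R : realType) (n m nz : nat)
    (A : 'M[R]_nz) (B : 'M[R]_(nz, m)) (C : 'M[R]_(n, nz))
    (Q : 'M[R]_n) (Rc : 'M[R]_m) (P : 'M[R]_nz) (F : 'M[R]_(m, nz)) x :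
  posdefmx Rc -> psdmx P ->
  qf (riccati_map A B C Q Rc P) x <=
  qf (stage_cost C Q Rc F) x + qf P ((A + B *m F) *m x).
Proof.
move=> Rpd Ppsd; rewrite -qf_congr -qfD (riccati_completion A B C Q F Rpd Ppsd).
rewrite qfD lerDl qf_congr.
by have [_] := posdef_psdmx (posdefmxD Rpd (psdmx_congr B Ppsd)); exact.
Qed.

Lemma psdmx_stage_cost (R : realType) (n m nz : nat) (C : 'M[R]_(n, nz))
    (Q : 'M[R]_n) (Rc : 'M[R]_m) (F : 'M[R]_(m, nz)) :
  posdefmx Q -> posdefmx Rc -> psdmx (stage_cost C Q Rc F).
Proof. by move=> Qpd Rpd; apply: psdmxD; apply/psdmx_congr/posdef_psdmx. Qed.

Lemma psdmx_riccati_map (R : realType) (n m nz : nat)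
    (A : 'M[R]_nz) (B : 'M[R]_(nz, m)) (C : 'M[R]_(n, nz))
    (Q : 'M[R]_n) (Rc : 'M[R]_m) (P : 'M[R]_nz) :
  posdefmx Q -> posdefmx Rc -> psdmx P -> psdmx (riccati_map A B C Q Rc P).
Proof.
move=> Qpd Rpd Ppsd; rewrite riccati_map_gain //.
by apply: psdmxD; [exact: psdmx_stage_cost|exact: psdmx_congr].
Qed.

(** Compare both values with the one-step cost of the gain that is optimal for
    [P']: for [P] it is an upper bound, for [P'] it is exact. *)
Lemma riccati_map_mono (R : realType) (n m nz : nat)
    (A : 'M[R]_nz) (B : 'M[R]_(nz, m)) (C : 'M[R]_(n, nz))
    (Q : 'M[R]_n) (Rc : 'M[R]_m) (P P' : 'M[R]_nz) :
  posdefmx Rc -> psdmx P -> psdmx P' ->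
  (forall x, qf P x <= qf P' x) ->
  forall x, qf (riccati_map A B C Q Rc P) x
            <= qf (riccati_map A B C Q Rc P') x.
Proof.
move=> Rpd Ppsd P'psd PP' x.
apply: le_trans (qf_riccati_map_le A B C Q (lqr_gain A B Rc P') x Rpd Ppsd) _.
by rewrite (riccati_map_gain A B C Q Rpd P'psd) qfD qf_congr lerD2l.
Qed.

(** The only inverse in the Riccati map is that of [Rc + B^T P B], which stays
    invertible at the limit since [Rc] is definite. *)
Lemma cvg_riccati_map (R : realType) (n m nz : nat)
    (A : 'M[R]_nz) (B : 'M[R]_(nz, m)) (C : 'M[R]_(n, nz))
    (Q : 'M[R]_n) (Rc : 'M[R]_m) (P : nat -> 'M[R]_nz) (L : 'M[R]_nz) :
  posdefmx Rc -> (forall k, psdmx (P k)) -> psdmx L ->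
  P k @[k --> \oo] --> L ->
  riccati_map A B C Q Rc (P k) @[k --> \oo] --> riccati_map A B C Q Rc L.
Proof.
move=> Rpd Ppsd Lpsd PL; rewrite /riccati_map.
have unitG X : psdmx X -> Rc + B^T *m X *m B \in unitmx.
  by move=> Xpsd; apply/posdef_unitmx/posdefmxD/psdmx_congr.
have cst p q (X : 'M[R]_(p, q)) : X @[_ --> \oo] --> X by exact: cvg_cst.
have inv : invmx (Rc + B^T *m P k *m B) @[k --> \oo]
    --> invmx (Rc + B^T *m L *m B).
  apply: cvg_invmx; [by move=> k; exact: unitG|exact: unitG|].
  apply: cvgD; first exact: cst.
  by do ![exact: cst|exact: PL|apply: cvg_mulmx].
apply: cvgB; last by do ![exact: cst|exact: PL|exact: inv|apply: cvg_mulmx].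
apply: cvgD; first exact: cst.
by do ![exact: cst|exact: PL|apply: cvg_mulmx].
Qed.

(** * Observability *)

(** Shifting time trades a power of [A] for known terms:
    [C A^(i+1) y_k = C A^i y_(k+1) - C A^i B u_k].  By induction every
    [C A^i y_k] tends to 0, and the observability matrix has a left inverse. *)
Lemma cvg_observable (R : realType) (n m nz : nat)
    (A : 'M[R]_nz) (B : 'M[R]_(nz, m)) (C : 'M[R]_(n, nz))
    (y : nat -> 'cV[R]_nz) (u : nat -> 'cV[R]_m) :
  observable A C ->
  (forall k, y k.+1 = A *m y k + B *m u k) ->
  C *m y k @[k --> \oo] --> (0 : 'cV[R]_n) ->
  u k @[k --> \oo] --> (0 : 'cV[R]_m) ->
  y k @[k --> \oo] --> (0 : 'cV[R]_nz).
Proof.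
move=> obs yS Cy0 u0.
have cst p q (X : 'M[R]_(p, q)) : X @[_ --> \oo] --> X by exact: cvg_cst.
have CAy i : C *m A ^+ i *m y k @[k --> \oo] --> (0 : 'cV[R]_n).
  elim: i => [|i IH]; first by under eq_fun do rewrite expr0 mulmx1.
  have -> : (fun k => C *m A ^+ i.+1 *m y k) =
      (fun k => C *m A ^+ i *m y k.+1 - C *m A ^+ i *m B *m u k).
    apply/funext => k; rewrite yS exprSr mulmxDr !mulmxA.
    by rewrite addrK.
  rewrite -[X in _ --> X]subr0; apply: cvgB; first by
    move: IH; rewrite -cvg_shiftS.
  by rewrite -(mulmx0 _ (C *m A ^+ i *m B)); exact: cvg_mulmx.
have Ofull : row_full (observability_mx A C) by exact/eqP.
have -> : y = fun k => pinvmx (observability_mx A C)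
                         *m (observability_mx A C *m y k).
  by apply/funext => k; rewrite mulmxA mulVpmx // mul1mx.
rewrite -(mulmx0 _ (pinvmx (observability_mx A C))); apply: cvg_mulmx => //.
apply/mx_cvgP => i j.
rewrite mxE; under eq_fun do rewrite mxcol_mul mxE.
have /mx_cvgP/(_ (tagnat.sig2 i) j) := CAy (tagnat.sig1 i).
by rewrite mxE.
Qed.

Lemma observable_ker (R : realType) (n nz : nat) (A : 'M[R]_nz)
    (C : 'M[R]_(n, nz)) (x : 'cV[R]_nz) :
  observable A C -> (forall i, C *m A ^+ i *m x = 0) -> x = 0.
Proof.
move=> obs CAx.
have Ofull : row_full (observability_mx A C) by exact/eqP.
rewrite -[x]mul1mx -(mulVpmx Ofull) -mulmxA mxcol_mul.
under eq_mxcol => i do rewrite CAx.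
by rewrite mxcol0 mulmx0.
Qed.

(** * The closed loop of a positive definite solution *)

(** Coercivity of a definite form, one coordinate at a time.  With
    [w = M^-1 e_i] the coordinate [v_i] equals [w^T M v], so this is the
    Cauchy-Schwarz inequality for [M], with constant [qf M w]. *)
Lemma posdef_entry_le (R : realType) (p : nat) (M : 'M[R]_p) (i : 'I_p) :
  posdefmx M -> exists c : R, forall v : 'cV[R]_p, (v i 0) ^+ 2 <= c * qf M v.
Proof.
move=> Mpd; have [Msym Mpos] := Mpd.
pose w : 'cV[R]_p := invmx M *m delta_mx i 0.
have Mw : M *m w = delta_mx i 0 by rewrite mulKVmx ?posdef_unitmx.
have w0 : w != 0.
  apply/eqP => w0; move: Mw; rewrite w0 mulmx0 => /matrixP/(_ i 0).
  by rewrite !mxE !eqxx => /eqP; rewrite eq_sym oner_eq0.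
exists (qf M w) => v.
have a0 : 0 < qf M w by exact: Mpos.
have wMv : (w^T *m M *m v) 0 0 = v i 0.
  by rewrite -{1}Msym -trmx_mul Mw trmx_delta -rowE mxE.
have vMw : (v^T *m M *m w) 0 0 = v i 0.
  by rewrite -mulmxA Mw -colE !mxE.
(* Cauchy-Schwarz: positivity at this vector is the discriminant inequality,
   up to the positive factor [qf M w]. *)
have := (posdef_psdmx Mpd).2 (qf M w *: v - v i 0 *: w).
have -> : qf M (qf M w *: v - v i 0 *: w) =
    qf M w * (qf M w * qf M v - (v i 0) ^+ 2).
  rewrite {1}/qf [(_ - _)^T]linearB /= !(mulmxBl, mulmxBr).
  rewrite ![(_ *: _)^T]linearZ /= -!(scalemxAl, scalemxAr).
  have E X Y : (X - Y : 'M[R]_1) 0 0 = X 0 0 - Y 0 0 by rewrite !mxE.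
  have Z a X : (a *: X : 'M[R]_1) 0 0 = a * X 0 0 by rewrite !mxE.
  rewrite !(E, Z) wMv vMw -!/(qf _ _); ring.
by rewrite pmulr_rge0 // subr_ge0.
Qed.

Lemma cvg_qf0 (R : realType) (p : nat) (M : 'M[R]_p) (v : nat -> 'cV[R]_p) :
  posdefmx M -> qf M (v k) @[k --> \oo] --> (0 : R) ->
  v k @[k --> \oo] --> (0 : 'cV[R]_p).
Proof.
move=> Mpd Mv; apply/mx_cvgP => i j; rewrite ord1 mxE.
have [c vc] := posdef_entry_le i Mpd.
have sq0 : (v k i 0) ^+ 2 @[k --> \oo] --> (0 : R).
  apply: (@squeeze_cvgr _ _ _ _ (fun=> 0) (fun k => c * qf M (v k))).
  - by apply: nearW => k; rewrite sqr_ge0 vc.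
  - exact: cvg_cst.
  - by rewrite -(mulr0 c); exact: cvgMl_tmp.
apply/cvgrPdist_lt => e e0; move/cvgrPdist_lt: sq0 => /(_ (e ^+ 2)).
rewrite exprn_gt0 // => /(_ isT); apply: filterS => k.
by rewrite !sub0r !normrN normrX ltr_pXn2r ?nnegrE // ltW.
Qed.

Lemma cvg_qf_vec (R : realType) (p : nat) (M : 'M[R]_p) (v : nat -> 'cV[R]_p) :
  v k @[k --> \oo] --> (0 : 'cV[R]_p) -> qf M (v k) @[k --> \oo] --> (0 : R).
Proof.
move=> v0; rewrite /qf.
have /mx_cvgP/(_ 0 0) : (v k)^T *m M *m v k @[k --> \oo] --> (0 : 'M[R]_1).
  rewrite -(mulmx0 1 (0 *m M)); apply: cvg_mulmx => //.
  apply: cvg_mulmx; last exact: cvg_cst.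
  apply/mx_cvgP => i j; under eq_fun do rewrite mxE; rewrite mxE.
  by move/mx_cvgP/(_ j i): v0; rewrite mxE.
by rewrite mxE.
Qed.

(** [qf P] is a Lyapunov function for the closed loop, but it need not decrease
    strictly.  Its decrease bounds the output and the input, and observability
    supplies the rest. *)
Lemma riccati_closed_loop_cvg0 (R : realType) (n m nz : nat)
    (A : 'M[R]_nz) (B : 'M[R]_(nz, m)) (C : 'M[R]_(n, nz))
    (Q : 'M[R]_n) (Rc : 'M[R]_m) (P : 'M[R]_nz) :
  observable A C -> posdefmx Q -> posdefmx Rc -> posdefmx P ->
  riccati_eq A B C Q Rc P ->
  (A + B *m lqr_gain A B Rc P) ^+ k @[k --> \oo] --> (0 : 'M[R]_nz).
Proof.
move=> obs Qpd Rpd Ppd Peq; set K := lqr_gain A B Rc P.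
have Ppsd := posdef_psdmx Ppd.
suff yx0 (x : 'cV[R]_nz) :
    (A + B *m K) ^+ k *m x @[k --> \oo] --> (0 : 'cV[R]_nz).
  apply/mx_cvgP => i j; have /mx_cvgP/(_ i 0) := yx0 (delta_mx j 0).
  by under eq_fun do rewrite -colE mxE; rewrite !mxE.
pose y k := (A + B *m K) ^+ k *m x.
have yS k : y k.+1 = (A + B *m K) *m y k by rewrite /y exprS mulmxA.
have Vdec k : qf P (y k) - qf P (y k.+1)
    = qf Q (C *m y k) + qf Rc (K *m y k).
  have := qf_riccati_map A B C Q (y k) Rpd Ppsd.
  rewrite /= [riccati_map _ _ _ _ _ _](esym Peq) -/K -yS => ->.
  by rewrite addrK.
have Qge0 := (posdef_psdmx Qpd).2; have Rge0 := (posdef_psdmx Rpd).2.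
have Vcvg : cvgn (fun k => qf P (y k)).
  apply: nonincreasing_is_cvgn.
    apply/nonincreasing_seqP => k.
    by rewrite -subr_ge0 Vdec addr_ge0.
  by exists 0 => _ [k _ <-]; exact: Ppsd.2.
have dV0 : qf P (y k) - qf P (y k.+1) @[k --> \oo] --> (0 : R).
  rewrite -(subrr (limn (fun k => qf P (y k)))); apply: cvgB => //.
  by rewrite (@cvg_shiftS _ (fun k => qf P (y k))).
have Cy0 : C *m y k @[k --> \oo] --> (0 : 'cV[R]_n).
  apply: (cvg_qf0 Qpd).
  apply: (@squeeze_cvgr _ _ _ _ (fun=> 0) _ _ _ _ _ dV0); last exact: cvg_cst.
  by apply: nearW => k; rewrite Qge0 Vdec lerDl Rge0.
have Ky0 : K *m y k @[k --> \oo] --> (0 : 'cV[R]_m).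
  apply: (cvg_qf0 Rpd).
  apply: (@squeeze_cvgr _ _ _ _ (fun=> 0) _ _ _ _ _ dV0); last exact: cvg_cst.
  by apply: nearW => k; rewrite Rge0 Vdec lerDr Qge0.
apply: (cvg_observable obs _ Cy0 Ky0) => k.
by rewrite yS mulmxDl mulmxA.
Qed.

Lemma qf_inj (R : realType) (p : nat) (M N : 'M[R]_p) :
  M^T = M -> N^T = N -> (forall x, qf M x = qf N x) -> M = N.
Proof.
by move=> Ms Ns MN; apply/matrixP => i j; rewrite !qf_polar // !MN.
Qed.

(** The gain of [P'] is optimal for [P'] and only admissible for [P], so
    [qf P - qf P'] does not decrease along the closed loop of [P'].  That loop
    converges to 0, where the difference vanishes. *)
Lemma riccati_sol_le (R : realType) (n m nz : nat)
    (A : 'M[R]_nz) (B : 'M[R]_(nz, m)) (C : 'M[R]_(n, nz))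
    (Q : 'M[R]_n) (Rc : 'M[R]_m) (P P' : 'M[R]_nz) :
  observable A C -> posdefmx Q -> posdefmx Rc -> posdefmx P -> posdefmx P' ->
  riccati_eq A B C Q Rc P -> riccati_eq A B C Q Rc P' ->
  forall x, qf P x <= qf P' x.
Proof.
move=> obs Qpd Rpd Ppd P'pd Peq P'eq x.
have Ppsd := posdef_psdmx Ppd; have P'psd := posdef_psdmx P'pd.
have M0 := riccati_closed_loop_cvg0 obs Qpd Rpd P'pd P'eq.
set M := A + _ in M0.
have step y : qf P y - qf P' y <= qf P (M *m y) - qf P' (M *m y).
  have := qf_riccati_map_le A B C Q (lqr_gain A B Rc P') y Rpd Ppsd.
  rewrite [riccati_map _ _ _ _ _ _](esym Peq) -/M => PM.
  have : qf P' y = qf (stage_cost C Q Rc (lqr_gain A B Rc P')) y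
      + qf P' (M *m y).
    rewrite {1}P'eq -[in LHS]/(riccati_map A B C Q Rc P').
    by rewrite riccati_map_gain // qfD qf_congr.
  by move: PM; lra.
have iter_step k : qf P x - qf P' x
    <= qf P (M ^+ k *m x) - qf P' (M ^+ k *m x).
  elim: k => [|k IH]; first by rewrite expr0 mul1mx.
  by apply: le_trans IH _; rewrite exprS -mulmxA; exact: step.
have y0 : M ^+ k *m x @[k --> \oo] --> (0 : 'cV[R]_nz).
  by rewrite -(mul0mx _ x); apply: cvg_mulmx => //; exact: cvg_cst.
rewrite -subr_le0; apply: (@ler_cvg_to nat \oo _ R (fun=> qf P x - qf P' x)
  (fun k => qf P (M ^+ k *m x) - qf P' (M ^+ k *m x))).
- exact: cvg_cst.
- by rewrite -[X in _ --> X](subrr 0); apply: cvgB; exact: cvg_qf_vec.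
- by apply: nearW => k; exact: iter_step.
Qed.

(** * Summability of the powers of a Schur stable matrix *)

(** Bounded partial sums, rather than convergence of the series, since this
    makes sense and suffices without completeness. *)
Definition summable_seq (K : numDomainType) (a : nat -> K) : Prop :=
  exists c : K, forall N, \sum_(k < N) `|a k| <= c.

(** If [S_N] is the partial sum for [a] and [c] bounds those of the defect
    [a_(k+1) - z a_k], then [S_N <= S_(N+1) <= |a_0| + c + |z| S_N]. *)
Lemma summable_seq_recurrence (K : numFieldType) (z : K) (a : nat -> K) :
  `|z| < 1 -> summable_seq (fun k => a k.+1 - z * a k) -> summable_seq a.
Proof.
move=> z1 [c ac]; exists ((`|a 0%N| + c) / (1 - `|z|)) => N.
rewrite ler_pdivlMr ?subr_gt0 // mulrBr mulr1 lerBlDr.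
apply: (@le_trans _ _ (\sum_(k < N.+1) `|a k|)).
  by rewrite big_ord_recr /= lerDl.
rewrite big_ord_recl /= -addrA lerD2l mulr_suml.
rewrite -lerBlDr; apply: le_trans (ac N); rewrite -sumrB.
apply: ler_sum => k _; rewrite lerBlDr [_ * `|z|]mulrC -normrM.
by rewrite -{1}[a k.+1](subrK (z * a k)) ler_normD.
Qed.

(** The roots in [r] are removed one at a time: multiplying [p] by ['X - z]
    replaces the sequence [p(M) M^k] by its defect [p(M) M^(k+1) - z p(M) M^k],
    to which [summable_seq_recurrence] applies.  When all roots are used up the
    sequence is zero. *)
Lemma summable_horner_mx (K : numFieldType) (n' : nat) (M : 'M[K]_n'.+1)
    (r : seq K) (p : {poly K}) :
  {in r, forall z, `|z| < 1} ->
  horner_mx M (\prod_(z <- r) ('X - z%:P) * p) = 0 ->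
  forall i j, summable_seq (fun k => horner_mx M (p * 'X^k) i j).
Proof.
elim: r p => [|z r IH] p r1 Mp i j.
  exists 0 => N; rewrite big1 // => k _.
  move: Mp; rewrite big_nil mul1r => Mp.
  by rewrite rmorphM /= Mp mul0r mxE normr0.
apply: (@summable_seq_recurrence _ z); first by apply: r1; rewrite mem_head.
have [||c Mc] := IH (('X - z%:P) * p) _ _ i j.
- by move=> x xr; apply: r1; rewrite in_cons xr orbT.
- by rewrite mulrCA mulrA; move: Mp; rewrite big_cons.
exists c => N; apply: le_trans (Mc N); apply: ler_sum => k _.
rewrite le_eqVlt; apply/orP; left; apply/eqP; congr `|_|.
have -> : ('X - z%:P) * p * 'X^k = p * 'X^(k.+1) - z%:P * (p * 'X^k).
  by rewrite exprS; ring.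
by rewrite rmorphB /= [horner_mx M (_%:P * _)]rmorphM /= horner_mx_C
  -mulmxE mul_scalar_mx !mxE.
Qed.

(** Over the complex numbers the characteristic polynomial splits, its roots are
    the eigenvalues, and it annihilates the matrix by Cayley-Hamilton. *)
Lemma schur_stable_summable (R : realType) (n : nat) (M : 'M[R]_n) :
  schur_stable M -> exists c : R, forall N, \sum_(k < N) `|M ^+ k| <= c.
Proof.
case: n M => [|n'] M Mst.
  exists 0 => N; rewrite big1 // => k _.
  by apply/eqP; rewrite normr_eq0 flatmx0.
pose MC := map_mx (real_complex R) M.
have [r rE] := closed_field_poly_normal (char_poly MC).
move: rE; rewrite (monicP (char_poly_monic MC)) scale1r => rE.
have r1 : {in r, forall z, `|z| < 1}.
  by move=> z zr; apply: Mst; rewrite eigenvalue_root_char rE root_prod_XsubC.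
have CH : horner_mx MC (\prod_(z <- r) ('X - z%:P) * 1) = 0.
  by rewrite mulr1 -rE Cayley_Hamilton.
have entry i j : exists c : R, forall N, \sum_(k < N) `|(M ^+ k) i j| <= c.
  have [c Mc] := summable_horner_mx r1 CH i j.
  exists (complex.Re c) => N; have := Mc N.
  have -> : \sum_(k < N) `|horner_mx MC (1 * 'X^k) i j| =
      (\sum_(k < N) `|(M ^+ k) i j|)%:C%C.
    rewrite rmorph_sum; apply: eq_bigr => k _ /=.
    rewrite mul1r rmorphXn /= horner_mx_X -rmorphXn /= mxE normc_def /=.
    by rewrite expr0n /= addr0 sqrtr_sqr.
  by rewrite lecE /= => /andP[].
have [c Mc] := choice (fun ij => entry ij.1 ij.2).
exists (\sum_ij c ij) => N.
apply: (@le_trans _ _ (\sum_(k < N) \sum_ij `|(M ^+ k) ij.1 ij.2|)).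
  apply: ler_sum => k _; apply: mx_norm_le_entries => [|i j].
    exact: sumr_ge0.
  by rewrite (bigD1 (i, j)) //= lerDl sumr_ge0.
by rewrite exchange_big; apply: ler_sum => ij _; exact: Mc.
Qed.

(** * Existence of a definite solution *)

Lemma qf_le_norm (R : realType) (p : nat) (M : 'M[R]_p) (x : 'cV[R]_p) :
  qf M x <= (p%:R ^+ 2 * `|M|) * `|x| ^+ 2.
Proof.
apply: le_trans (ler_norm _) _; apply: le_trans (mx_entry_le_norm _ _ _) _.
have xT : `|x^T| <= `|x|.
  by apply: mx_norm_le_entries => // i j; rewrite mxE mx_entry_le_norm.
apply: le_trans (mulmx_norm_le _ _) _.
have -> : p%:R ^+ 2 * `|M| * `|x| ^+ 2 = p%:R * (p%:R * `|x| * `|M|) * `|x|.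
  by ring.
rewrite ler_wpM2r // ler_wpM2l //; apply: le_trans (mulmx_norm_le _ _) _.
by rewrite ler_wpM2r // ler_wpM2l.
Qed.

(** The cost at time [k] is of the order of [|M^k|^2], which is summable because
    [|M^k|] is both bounded and summable. *)
Lemma schur_stable_cost_bounded (R : realType) (p : nat) (M S : 'M[R]_p)
    (x : 'cV[R]_p) :
  schur_stable M ->
  exists c : R, forall N, \sum_(k < N) qf S (M ^+ k *m x) <= c.
Proof.
move=> /schur_stable_summable[c Mc].
have M_le k : `|M ^+ k| <= c.
  by apply: le_trans (Mc k.+1); rewrite big_ord_recr /= lerDr sumr_ge0.
pose b : R := p%:R ^+ 2 * `|S| * (p%:R * `|x|) ^+ 2 * c.
have b0 : 0 <= b.
  by rewrite !mulr_ge0 ?exprn_ge0 ?mulr_ge0 // (le_trans _ (M_le 0%N)).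
exists (b * c) => N; apply: le_trans (ler_wpM2l b0 (Mc N)).
rewrite mulr_sumr; apply: ler_sum => k _.
apply: le_trans (qf_le_norm _ _) _.
have -> : b * `|M ^+ k| =
    p%:R ^+ 2 * `|S| * ((p%:R * `|x|) ^+ 2 * (c * `|M ^+ k|)).
  by rewrite /b; ring.
rewrite ler_wpM2l ?mulr_ge0 ?exprn_ge0 //.
apply: (@le_trans _ _ ((p%:R * `|M ^+ k| * `|x|) ^+ 2)).
  by rewrite ler_pXn2r ?nnegrE ?mulr_ge0 // mulmx_norm_le.
have -> : (p%:R * `|M ^+ k| * `|x|) ^+ 2
    = (p%:R * `|x|) ^+ 2 * (`|M ^+ k| * `|M ^+ k|) by ring.
by rewrite ler_wpM2l ?exprn_ge0 ?mulr_ge0 // ler_wpM2r.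
Qed.

Lemma nondecreasing_psdmx_cvg (R : realType) (p : nat) (P : nat -> 'M[R]_p) :
  (forall k, psdmx (P k)) ->
  (forall k x, qf (P k) x <= qf (P k.+1) x) ->
  (forall x, exists c, forall k, qf (P k) x <= c) ->
  exists2 L, psdmx L & P k @[k --> \oo] --> L.
Proof.
move=> Ppsd Pmono Pbnd.
have Pcvg x : cvgn (fun k => qf (P k) x).
  apply: nondecreasing_is_cvgn; first by apply/nondecreasing_seqP => k.
  by have [c Pc] := Pbnd x; exists c => _ [k _ <-].
pose l x := limn (fun k => qf (P k) x).
pose L : 'M[R]_p := \matrix_(i, j) (2^-1 * (l (delta_mx i 0 + delta_mx j 0)
                  - l (delta_mx i 0) - l (delta_mx j 0))).
have PL : P k @[k --> \oo] --> L.
  apply/mx_cvgP => i j; rewrite mxE.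
  under eq_fun do rewrite (qf_polar _ _ (Ppsd _).1).
  by apply: cvgMl_tmp; apply: cvgB; [apply: cvgB|]; exact: Pcvg.
exists L => //; split.
  apply/matrixP => i j; rewrite !mxE [delta_mx j 0 + _]addrC.
  by congr (_ * _); rewrite -!addrA; congr (_ + _); rewrite addrC.
move=> x; apply: (@ler_cvg_to nat \oo _ R (fun=> 0) (fun k => qf (P k) x)).
- exact: cvg_cst.
- exact: cvg_qf.
- by apply: nearW => k; exact: (Ppsd k).2.
Qed.

(** If [qf P x = 0] then every term of [qf_riccati_map] vanishes, so [C x = 0] and
    the feedback vanishes at [x].  The closed loop then moves [x] to [A x], where
    [qf P] is again 0.  So all outputs [C A^i x] vanish. *)
Lemma riccati_sol_posdef (R : realType) (n m nz : nat)
    (A : 'M[R]_nz) (B : 'M[R]_(nz, m)) (C : 'M[R]_(n, nz))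
    (Q : 'M[R]_n) (Rc : 'M[R]_m) (P : 'M[R]_nz) :
  observable A C -> posdefmx Q -> posdefmx Rc -> psdmx P ->
  riccati_eq A B C Q Rc P -> posdefmx P.
Proof.
move=> obs Qpd Rpd Ppsd Peq; split; first exact: Ppsd.1.
move=> x x0; rewrite -/(qf P x) lt_neqAle Ppsd.2 andbT eq_sym.
apply: contraNneq x0 => Px0; apply/eqP.
have step y : qf P y = 0 -> C *m y = 0 /\ qf P (A *m y) = 0.
  have := qf_riccati_map A B C Q y Rpd Ppsd.
  rewrite /= [riccati_map _ _ _ _ _ _](esym Peq); set K := lqr_gain _ _ _ _.
  move=> -> /eqP.
  have Q0 := (posdef_psdmx Qpd).2 (C *m y).
  have R0 := (posdef_psdmx Rpd).2 (K *m y).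
  rewrite paddr_eq0 ?addr_ge0 ?Ppsd.2 // paddr_eq0 //.
  move=> /andP[/andP[/eqP/(posdef_qf0 Qpd) -> /eqP/(posdef_qf0 Rpd) Ky] /eqP].
  by rewrite mulmxDl -mulmxA Ky mulmx0 addr0.
have PA i : qf P (A ^+ i *m x) = 0.
  elim: i => [|i IH]; first by rewrite expr0 mul1mx.
  by rewrite exprS -mulmxA; exact: (step _ IH).2.
apply: (observable_ker obs) => i.
by rewrite -mulmxA; exact: (step _ (PA i)).1.
Qed.

(** Value iteration: the [k]-th iterate from 0 is the optimal cost over [k]
    steps. *)
Lemma riccati_sol_exists (R : realType) (n m nz : nat)
    (A : 'M[R]_nz) (B : 'M[R]_(nz, m)) (C : 'M[R]_(n, nz))
    (Q : 'M[R]_n) (Rc : 'M[R]_m) :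
  stabilizable A B -> observable A C -> posdefmx Q -> posdefmx Rc ->
  exists2 P, posdefmx P & riccati_eq A B C Q Rc P.
Proof.
move=> [F Fst] obs Qpd Rpd.
pose P k := iter k (riccati_map A B C Q Rc) 0.
have Ppsd k : psdmx (P k).
  elim: k => [|k IH]; last exact: psdmx_riccati_map.
  by split=> [|x]; rewrite ?trmx0 // /qf mulmx0 mul0mx mxE.
have Pmono k x : qf (P k) x <= qf (P k.+1) x.
  elim: k x => [|k IH] x.
    by rewrite {1}/qf mulmx0 mul0mx mxE (Ppsd 1%N).2.
  exact: (riccati_map_mono A B C Q Rpd (Ppsd k) (Ppsd k.+1) IH).
have Pcost N x : qf (P N) x <=
    \sum_(k < N) qf (stage_cost C Q Rc F) ((A + B *m F) ^+ k *m x).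
  elim: N x => [|N IH] x; first by rewrite big_ord0 /qf mulmx0 mul0mx mxE.
  apply: le_trans (qf_riccati_map_le A B C Q F x Rpd (Ppsd N)) _.
  rewrite big_ord_recl expr0 mul1mx lerD2l; apply: le_trans (IH _) _.
  by apply: ler_sum => k _; rewrite mulmxA mulmxE -exprSr.
have [L Lpsd PL] : exists2 L, psdmx L & P k @[k --> \oo] --> L.
  apply: nondecreasing_psdmx_cvg => // x.
  have [c Sc] := schur_stable_cost_bounded (stage_cost C Q Rc F) x Fst.
  by exists c => k; exact: le_trans (Pcost k x) (Sc k).
have Leq : riccati_eq A B C Q Rc L.
  have PS : P k.+1 @[k --> \oo] --> L by rewrite (@cvg_shiftS _ P).
  exact: (cvg_unique (@norm_hausdorff _ _) PS
    (cvg_riccati_map Rpd Ppsd Lpsd PL)).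
by exists L => //; exact: (riccati_sol_posdef obs Qpd Rpd Lpsd Leq).
Qed.

(** * Stability of the nonlinear closed loop *)

Theorem theorem1 (R : realType) (n m nz : nat) (hnz : (n <= nz)%N)
  (f : 'cV[R]_n * 'cV[R]_m -> 'cV[R]_n)
  (hf : continuously_differentiable f) (hf0 : f (0, 0) = 0)
  (Psi : 'cV[R]_n -> 'cV[R]_nz)
  (hPsi : continuous Psi) (hPsi0 : Psi 0 = 0)
  (A : 'M[R]_nz) (B : 'M[R]_(nz, m)) (C : 'M[R]_(n, nz))
  (hC : forall x : 'cV[R]_n, C *m Psi x = x)
  (hAB : stabilizable A B) (hAC : observable A C)
  (Q : 'M[R]_n) (Rc : 'M[R]_m) (hQ : posdefmx Q) (hRc : posdefmx Rc)
  (hlin : forall (x : 'cV[R]_n) (u : 'cV[R]_m),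
     Psi (f (x, u)) = A *m Psi x + B *m u) :
  exists P : 'M[R]_nz,
    unique (fun P' : 'M[R]_nz => posdefmx P' /\ riccati_eq A B C Q Rc P') P /\
    globally_asymptotically_stable
      (fun x : 'cV[R]_n => f (x, lqr_gain A B Rc P *m Psi x)).
Proof.
have [P Ppd Peq] := riccati_sol_exists hAB hAC hQ hRc.
exists P; split.
  split=> // P' [P'pd P'eq]; apply: qf_inj; [exact: Ppd.1|exact: P'pd.1|].
  move=> x; apply/eqP; rewrite eq_le.
  have le12 := riccati_sol_le hAC hQ hRc Ppd P'pd Peq P'eq.
  by rewrite le12 (riccati_sol_le hAC hQ hRc P'pd Ppd P'eq Peq).
have M0 := riccati_closed_loop_cvg0 hAC hQ hRc Ppd Peq.
set K := lqr_gain A B Rc P in M0 *; set M := A + B *m K in M0.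
set g := fun x => _.
have xE t x0 : iter t g x0 = C *m M ^+ t *m Psi x0.
  rewrite -mulmxA -[LHS]hC; congr (C *m _).
  elim: t => [|t IH]; first by rewrite mul1mx.
  rewrite iterS /g hlin IH exprS -mulmxA [RHS]mulmxDl; congr (_ + _).
  exact: mulmxA.
have CM0 : C *m M ^+ t @[t --> \oo] --> (0 : 'M[R]_(n, nz)).
  by rewrite -(mulmx0 _ C); apply: cvg_mulmx => //; exact: cvg_cst.
split=> [x0|e e0].
  under eq_fun do rewrite xE.
  by rewrite -(mul0mx _ (Psi x0)); apply: cvg_mulmx => //; exact: cvg_cst.
(* [nz.+1] in place of the factor [nz] of [mulmx_norm_le], to divide by it
   also when [nz = 0]. *)
have [c c0 CMc] : exists2 c : R, 0 < c & forall t, `|C *m M ^+ t| <= c.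
  have /cvg_seq_bounded/pinfty_ex_gt0[c c0 CMc] : cvgn (fun t => C *m M ^+ t).
    by apply/cvg_ex; exists 0.
  by exists c => // t; exact: CMc.
have b0 : 0 < nz.+1%:R * c by rewrite mulr_gt0.
have : \forall x \near (0 : 'cV[R]_n), `|Psi 0 - Psi x| < e / (nz.+1%:R * c).
  have /cvgrPdist_lt := hPsi 0; apply; exact: divr_gt0.
move=> /nbhs_normP[d /= d0 dPsi]; exists d => // x0 x0d t.
have := dPsi x0; rewrite /= sub0r normrN => /(_ x0d).
rewrite hPsi0 sub0r normrN ltr_pdivlMr // mulrC => Psi_lt.
rewrite xE; apply: le_lt_trans (mulmx_norm_le _ _) (le_lt_trans _ Psi_lt).
rewrite ler_wpM2r //; apply: ler_pM => //.
by rewrite ler_nat.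
Qed.
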